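(* For every atomic representable $\{-,\triangleright\}$-algebra $\mathfrak A$, the homomorphism $$\eta_{\mathfrak A}\colon\mathfrak A\to (G\circ F)(\mathfrak A)=\{f\colon\mathrm{At}(\mathfrak A)/{\sim_{\mathfrak A}}\rightharpoonup\mathrm{At}(\mathfrak A)\mid f\subseteq\pi_{\mathfrak A}^{-1}\},\qquad a\mapsto\{([x],x)\mid x\in\mathrm{At}(\mathfrak A)\text{ and }x\le a\},$$ is the compatible completion of $\mathfrak A$.
   Context: A partial function from $X$ to $Y$ is a set $f\subseteq X\times Y$ such that $(x,y),(x,z)\in f$ implies $y=z$; $\mathrm{dom}(f)=\{x\mid \exists y\,(x,y)\in f\}$; $f\colon X\rightharpoonup Y$ denotes a partial function. An algebra of partial functions of the signature $\{-,\triangleright\}$ is a nonempty set of partial functions from some common set $X$ to some common set $Y$, closed under relative complement $f-g$ (set difference) and domain restriction $f\triangleright g=\{(x,y)\in g\mid x\in\mathrm{dom}(f)\}$. An abstract $\{-,\triangleright\}$-algebra (two binary operations) is representable if it is isomorphic to an algebra of partial functions. Put $a\cdot b:=a-(a-b)$; a representable algebra is partially ordered by $a\le b\iff a\cdot b=a$, with binary meet $\cdot$ and least element $0$. An atom is a minimal nonzero element; $\mathrm{At}(\mathfrak A)$ is the set of atoms; $\mathfrak A$ is atomic if every nonzero element is above an atom. On a representable $\mathfrak A$ let $a\preceq_{\mathfrak A}b\iff a\le b\triangleright a$ (a preorder), with induced equivalence relation $\sim_{\mathfrak A}$; $[a]$ is the class of $a$. $\pi_{\mathfrak A}\colon\mathrm{At}(\mathfrak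 A)\twoheadrightarrow\mathrm{At}(\mathfrak A)/{\sim_{\mathfrak A}}$ is the canonical projection, and $\pi_{\mathfrak A}^{-1}=\{([x],x)\mid x\in\mathrm{At}(\mathfrak A)\}$. The set $(G\circ F)(\mathfrak A)$ displayed in the claim is a $\{-,\triangleright\}$-algebra of partial functions. Elements $a,b$ of a representable algebra are compatible if $a\triangleright b=b\triangleright a$. A representable algebra is compatibly complete if every subset of pairwise-compatible elements has a join. A subset $S$ of a poset is join dense if every element of the poset is the join of some subset of $S$. A compatible completion of a representable algebra $\mathfrak A$ is an embedding (injective homomorphism) $\iota\colon\mathfrak A\hookrightarrow\mathfrak C$ of $\{-,\triangleright\}$-algebras such that $\mathfrak C$ is representable and compatibly complete and $\iota[\mathfrak A]$ is join dense in $\mathfrak C$. (One says ''the'' compatible completion because it is unique up to unique isomorphism.) *)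

(* Defs.v *)
From mathcomp Require Import all_boot.
From mathcomp Require Import boolp classical_sets.

Set Implicit Arguments.
Unset Strict Implicit.
Unset Printing Implicit Defensive.

Local Open Scope classical_set_scope.

Declare Scope pf_scope.
Delimit Scope pf_scope with pf.

Section PartialFunctions.
Context {X Y : Type}.

Definition is_pfun (f : set (X * Y)) : Prop :=
  forall x y z, f (x, y) -> f (x, z) -> y = z.

Definition pf_dom (f : set (X * Y)) : set X := [set x | exists y, f (x, y)].

(* The second argument is the one being restricted. *)
Definition pf_restr (f g : set (X * Y)) : set (X * Y) :=
  [set p | pf_dom f p.1 /\ g p].

Record is_pf_algebra (S : set (set (X * Y))) : Prop := IsPfAlgebra {
  pf_algebra_neq0 : S !=set0;
  pf_algebra_pfun : forall f, S f -> is_pfun f;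
  pf_algebra_diff : forall f g, S f -> S g -> S (f `\` g);
  pf_algebra_restr : forall f g, S f -> S g -> S (pf_restr f g) }.

End PartialFunctions.

Record algebra := Algebra {
  carrier :> Type;
  diff : carrier -> carrier -> carrier;
  restr : carrier -> carrier -> carrier }.

Notation "a - b" := (diff a b) : pf_scope.
Notation "a |> b" := (restr a b) (at level 40, left associativity) : pf_scope.
Local Open Scope pf_scope.

Record is_hom (A B : algebra) (h : A -> B) : Prop := IsHom {
  hom_diff : forall a b, h (a - b) = h a - h b;
  hom_restr : forall a b, h (a |> b) = h a |> h b }.

Definition is_embedding (A B : algebra) (h : A -> B) : Prop :=
  is_hom h /\ injective h.

Definition isomorphic (A B : algebra) : Prop :=
  exists h : A -> B, is_hom h /\ bijective h.

Section PfAlgebra.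
Context {X Y : Type} {S : set (set (X * Y))} (algS : is_pf_algebra S).

Definition pfa_diff (f g : S) : S :=
  SigSub (mem_set (pf_algebra_diff algS (set_valP f) (set_valP g))).

Definition pfa_restr (f g : S) : S :=
  SigSub (mem_set (pf_algebra_restr algS (set_valP f) (set_valP g))).

Definition pf_algebra : algebra := Algebra pfa_diff pfa_restr.

End PfAlgebra.

Definition representable (A : algebra) : Prop :=
  exists (X Y : Type) (S : set (set (X * Y))) (algS : is_pf_algebra S),
    isomorphic A (pf_algebra algS).

Section Order.
Context {A : algebra}.
Implicit Types (a b : A) (S : set A).

Definition meet a b : A := a - (a - b).

Definition le a b : Prop := meet a b = a.

(* The least element; equal to [b - b] for every [b] when [A] is representable. *)
Definition is_zero a : Prop := forall b, le a b.

Definition is_atom a : Prop :=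
  ~ is_zero a /\ forall b, ~ is_zero b -> le b a -> b = a.

Definition preceq a b : Prop := le a (b |> a).

Definition sim a b : Prop := preceq a b /\ preceq b a.

Definition compatible a b : Prop := a |> b = b |> a.

Definition is_join S a : Prop :=
  (forall s, S s -> le s a) /\
  (forall b, (forall s, S s -> le s b) -> le a b).

Definition join_dense S : Prop :=
  forall a, exists T : set A, T `<=` S /\ is_join T a.

End Order.

Definition atoms (A : algebra) : set A := [set a | is_atom a].
Arguments atoms : clear implicits.

Definition atomic (A : algebra) : Prop :=
  forall a : A, ~ is_zero a -> exists2 x, atoms A x & le x a.

Definition compatibly_complete (A : algebra) : Prop :=
  forall S : set A, (forall a b, S a -> S b -> compatible a b) ->
    exists a, is_join S a.

Record is_compatible_completion (A C : algebra) (iota : A -> C) : Prop :=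
  IsCompatibleCompletion {
    completion_embedding : is_embedding iota;
    completion_representable : representable C;
    completion_complete : compatibly_complete C;
    completion_join_dense : join_dense (range iota) }.

Section AtomQuotient.
Variable A : algebra.

(* The classes of [sim] on atoms are taken as sets of atoms. *)
Definition atom_class (x : atoms A) : set (atoms A) :=
  [set y | sim (val x) (val y)].

Definition atom_quot : set (set (atoms A)) := range atom_class.

Definition atom_proj (x : atoms A) : atom_quot :=
  SigSub (mem_set (imageT atom_class x)).

Definition atom_proj_inv : set (atom_quot * atoms A) :=
  [set (atom_proj x, x) | x in [set: atoms A]].

(* [atom_proj_inv] is in general multivalued, whence the condition [is_pfun]. *)
Definition GF_set : set (set (atom_quot * atoms A)) :=
  [set f | is_pfun f /\ f `<=` atom_proj_inv].

Lemma GF_is_pf_algebra : is_pf_algebra GF_set.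
Proof.
split.
- by exists set0; split=> // ? ? ? [].
- by move=> f [].
- move=> f g [pf sf] _; split; last by move=> p [/sf].
  by move=> x y z [+ _] [+ _]; exact: pf.
- move=> f g _ [pg sg]; split; last by move=> p [_ /sg].
  by move=> x y z [_ +] [_ +]; exact: pg.
Qed.

Definition GF : algebra := pf_algebra GF_is_pf_algebra.

Definition eta_set (a : A) : set (atom_quot * atoms A) :=
  [set (atom_proj x, x) | x in [set x : atoms A | le (val x) a]].

End AtomQuotient.

Section Eta.
Variables (A : algebra) (reprA : representable A).

(* Representability is what makes [eta_set a] single-valued. *)
Lemma sim_le_eq (x y a : A) : le x a -> le y a -> sim x y -> x = y.
Proof.
case: reprA => X [Y [S [algS [h [[hD hR] /bij_inj h_inj]]]]].
have leP b c : le b c -> val (h b) `<=` val (h c).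
  move=> bc p; rewrite -{1}bc /meet !hD /= => -[bp nbc].
  by apply: contrapT => ncp; apply: nbc.
move=> xa ya [xy yx]; apply: h_inj; apply: val_inj.
have incl b c : le b a -> le c a -> preceq b c -> val (h b) `<=` val (h c).
  move=> ba ca bc [u v] hb; have := leP _ _ bc _ hb.
  rewrite hR => -[[w /= hc] _].
  have pfa := pf_algebra_pfun algS (set_valP (h a)).
  by rewrite (pfa _ _ _ (leP _ _ ba _ hb) (leP _ _ ca _ hc)).
by apply/seteqP; split; apply: incl.
Qed.

Lemma sim_refl (x : A) : sim x x.
Proof.
suff xx : preceq x x by [].
case: reprA => X [Y [S [algS [h [[hD hR] /bij_inj h_inj]]]]].
rewrite /preceq /le /meet; apply: h_inj; apply: val_inj.
rewrite !hD hR /=; apply/seteqP; split=> [p []//|[u v] xp]; split=> //.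
by move=> [_]; apply; split=> //; exists v.
Qed.

Lemma eta_set_GF (a : A) : GF_set (eta_set a).
Proof.
split; last by move=> _ [x _ <-]; exists x.
move=> q y z [x xa [<- <-]] [x' xa' [e <-]].
apply: val_inj; apply: (sim_le_eq xa xa').
have : atom_class x' x' by exact: sim_refl.
by rewrite e => -[].
Qed.

Definition eta (a : A) : GF A := SigSub (mem_set (eta_set_GF a)).

End Eta.

(* Main.v *)
From mathcomp Require Import all_boot.
From mathcomp Require Import boolp classical_sets.
Require Import Defs.

(** A representation of [A] turns the order into inclusion of graphs, [|>] into
    a comparison of domains, and the zero elements into the empty function.
    An atom [x] is then indecomposable for both operations: its graph lies
    inside, or is disjoint from, the graph of any [b] (consider [x - b]), and
    its domain lies inside, or is disjoint from, the domain of any [a]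
    (consider [a |> x]).  Hence [x <= a - b] means [x <= a] and not [x <= b],
    and, if [A] is atomic, [x <= a |> b] means that [x <= b] and some atom
    [y <= a] has the same domain as [x] (an atom below [x |> a] is one).
    As [sim] is equality of domains, these two equivalences
    ([atom_le_diff], [atom_le_restr]) say exactly that [eta] is a homomorphism.
    It is injective since a nonzero [a - b] has an atom below it, and that atom
    is below [a] but not below [b].

    The target consists of all single-valued subsets of one fixed relation, so
    the union of a pairwise compatible family is again in it and is the
    join ([GF_compatibly_complete]).  Finally [eta x] is the one-point function
    [{([x], x)}] when [x] is an atom, and every function is the union of its
    one-point restrictions, whence join density. *)

Set Implicit Arguments.
Unset Strict Implicit.
Unset Printing Implicit Defensive.

Local Open Scope classical_set_scope.
Local Open Scope pf_scope.

(** * Representations by partial functions *)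

Definition relational_representation (X Y : Type) (A : algebra)
    (r : A -> set (X * Y)) :=
  [/\ injective r, forall a b, r (a - b) = r a `\` r b &
      forall a b, r (a |> b) = pf_restr (r a) (r b)].

Lemma representable_representation (A : algebra) : representable A ->
  exists (X Y : Type) (r : A -> set (X * Y)), relational_representation r.
Proof.
move=> [X [Y [S [algS [h [[hD hR] /bij_inj h_inj]]]]]].
exists X, Y, (fun a => val (h a)); split=> [a b|a b|a b].
- by move=> /val_inj/h_inj.
- by rewrite hD.
- by rewrite hR.
Qed.

Lemma pf_algebra_representation (X Y : Type) (S : set (set (X * Y)))
    (algS : is_pf_algebra S) :
  @relational_representation X Y (pf_algebra algS) (fun f => val f).
Proof. by split=> // f g /val_inj. Qed.

Lemma pf_algebra_representable (X Y : Type) (S : set (set (X * Y)))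
    (algS : is_pf_algebra S) : representable (pf_algebra algS).
Proof. by exists X, Y, S, algS, id; split=> //; exists id. Qed.

Section Representation.
Context {X Y : Type} {A : algebra} {r : A -> set (X * Y)}.
Hypothesis rep : relational_representation r.
Implicit Types a b x y : A.

Lemma le_subset a b : le a b <-> r a `<=` r b.
Proof.
have [r_inj rD _] := rep; rewrite /le /meet; split=> [ab p|ab].
  by rewrite -{1}ab !rD => -[ap nabp]; apply: contrapT => nbp; apply: nabp.
apply: r_inj; rewrite !rD; apply/seteqP; split=> [p []//|p ap].
by split=> // -[_]; apply; exact: ab.
Qed.

Lemma is_zero_set0 a : is_zero a <-> r a = set0.
Proof.
have [_ rD _] := rep; split=> [a0|a0 b]; last by apply/le_subset; rewrite a0.
by rewrite -subset0 -(setDv (r a)) -rD; apply/le_subset.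
Qed.

Lemma preceq_subset a b : preceq a b <-> pf_dom (r a) `<=` pf_dom (r b).
Proof.
have [_ _ rR] := rep; rewrite /preceq le_subset rR; split=> [ab u [v av]|ab].
  by have [] := ab _ av.
by move=> [u v] av; split=> //; apply: ab; exists v.
Qed.

(** By minimality [x - a] is zero or [x], and the common point [p] rules out
    the latter. *)
Lemma atom_meets_le x a p : is_atom x -> r x p -> r a p -> le x a.
Proof.
have [_ rD _] := rep; move=> [_ xmin] xp ap.
have [/is_zero_set0|nz] := pselect (is_zero (x - a)).
  rewrite rD => xa0; apply/le_subset => q xq; apply: contrapT => naq.
  by have : (r x `\` r a) q by []; rewrite xa0.
have xax : x - a = x by apply: xmin nz _; apply/le_subset; rewrite rD => ? [].
by move: xp; rewrite -xax rD => -[].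
Qed.

(** By minimality [a |> x] is zero or [x], and [p] survives the restriction. *)
Lemma atom_meets_dom_preceq x a p : is_atom x -> r x p -> pf_dom (r a) p.1 ->
  preceq x a.
Proof.
have [_ _ rR] := rep; move=> [_ xmin] xp ap.
suff xax : a |> x = x by rewrite /preceq xax; apply/le_subset.
apply: xmin; last by apply/le_subset; rewrite rR => ? [].
move/is_zero_set0; rewrite rR => ax0.
by have : pf_restr (r a) (r x) p by []; rewrite ax0.
Qed.

End Representation.

(** * Atoms of a representable algebra *)

Section RepresentableAtoms.
Context {A : algebra}.
Hypothesis reprA : representable A.
Implicit Types a b x y : A.

Lemma le_refl a : le a a.
Proof.
by have [X [Y [r rep]]] := representable_representation reprA;
  apply/(le_subset rep).
Qed.

Lemma atom_le_diff x a b : is_atom x -> le x (a - b) <-> le x a /\ ~ le x b.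
Proof.
have [X [Y [r rep]]] := representable_representation reprA.
have [_ rD _] := rep => atx.
have [/(is_zero_set0 rep) x0] := atx => _.
rewrite (le_subset rep) rD; split=> [xab|[/(le_subset rep) xa nxb] p xp].
  split; first by apply/(le_subset rep) => p /xab [].
  move/(le_subset rep) => xb; apply: x0; rewrite -subset0 => p xp.
  by have [_] := xab p xp; apply; exact: xb.
by split; [exact: xa|move=> bp; apply: nxb; exact: atom_meets_le xp bp].
Qed.

(** The witness is any atom [y] below [x |> a]: its domain is contained in that
    of [x], and meeting the domain of the atom [x] it must also cover it. *)
Lemma atom_le_restr x a b : atomic A -> is_atom x ->
  le x (a |> b) <-> le x b /\ exists y, [/\ is_atom y, le y a & sim x y].
Proof.
have [X [Y [r rep]]] := representable_representation reprA.
have [_ _ rR] := rep => atomicA atx.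
have [x0 _] := atx.
rewrite (le_subset rep) rR; split=> [xab|[/(le_subset rep) xb]].
  split; first by apply/(le_subset rep) => p /xab [].
  have /atomicA[y aty] : ~ is_zero (x |> a).
    move/(is_zero_set0 rep); rewrite rR => xa0; apply: x0.
    apply/(is_zero_set0 rep); rewrite -subset0 => -[u v] xuv.
    have [[w auw] _] := xab _ xuv.
    suff : pf_restr (r x) (r a) (u, w) by rewrite xa0.
    by split=> //; exists v.
  move=> /(le_subset rep); rewrite rR => yxa; exists y; split=> //.
    by apply/(le_subset rep) => p /yxa [].
  have [y0 _] := aty.
  have [[u v] yuv] : r y !=set0.
    by apply/set0P/eqP => /(is_zero_set0 rep).
  have [[w /= xuw] _] := yxa _ yuv.
  split.
    by apply: (atom_meets_dom_preceq rep (p := (u, w))) => //; exists v.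
  by apply: (atom_meets_dom_preceq rep (p := (u, v))) => //; exists w.
move=> [y [_ /(le_subset rep) ya [/(preceq_subset rep) xy _]]] [u v] xuv.
split; last exact: xb.
have [|w yuw] := xy u; first by exists v.
by exists w; exact: ya.
Qed.

(** An atom below [a - b] would be below [a] and not below [b]. *)
Lemma atomic_le a b : atomic A ->
  (forall x, is_atom x -> le x a -> le x b) -> le a b.
Proof.
have [X [Y [r rep]]] := representable_representation reprA.
have [_ rD _] := rep => atomicA ab.
have [/(is_zero_set0 rep)|/atomicA[x atx]] := pselect (is_zero (a - b)).
  rewrite rD => ab0; apply/(le_subset rep) => p ap; apply: contrapT => nbp.
  by have : (r a `\` r b) p by []; rewrite ab0.
by move=> /(atom_le_diff _ _ atx)[/(ab _ atx)].
Qed.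

Lemma le_anti a b : le a b -> le b a -> a = b.
Proof.
have [X [Y [r rep]]] := representable_representation reprA.
have [r_inj _ _] := rep => /(le_subset rep) ab /(le_subset rep) ba.
by apply: r_inj; apply/seteqP.
Qed.

End RepresentableAtoms.

(** * The algebra of partial sections of the projection of atoms *)

Lemma atom_proj_eq (A : algebra) (reprA : representable A) (x y : atoms A) :
  atom_proj x = atom_proj y <-> sim (val x) (val y).
Proof.
have [X [Y [r rep]]] := representable_representation reprA.
have simE a b : sim a b <-> pf_dom (r a) = pf_dom (r b).
  rewrite /sim !(preceq_subset rep); split=> [[ab ba]|->].
    by apply/seteqP.
  by split.
split=> [[e]|/simE xy].
  suff : atom_class x y by [].
  by rewrite e; apply/simE.
by apply: val_inj; apply/seteqP; split=> z /simE zE; apply/simE;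
  rewrite -zE xy.
Qed.

Lemma eta_setE (A : algebra) (a : A) q (x : atoms A) :
  eta_set a (q, x) <-> q = atom_proj x /\ le (val x) a.
Proof. by split=> [[y ya [<- <-]]|[-> xa]] //; exists x. Qed.

Lemma GF_leE (A : algebra) (f g : GF A) : le f g <-> val f `<=` val g.
Proof. exact: (le_subset (pf_algebra_representation _)). Qed.

(** Compatible functions agree wherever both are defined, so the union of a
    pairwise compatible family is single-valued; inclusion in [atom_proj_inv]
    is inherited by unions.  The union is therefore in [GF A]. *)
Lemma GF_compatibly_complete (A : algebra) : compatibly_complete (GF A).
Proof.
move=> S compS.
have GFU : GF_set (\bigcup_(f in S) val f).
  split=> [q y z [f Sf fy] [g Sg gz]|p [f Sf fp]]; last first.
    by have [_] := set_valP f; apply.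
  (* [g] agrees with [f] on the domain of [f], by compatibility *)
  have fgz : pf_restr (val f) (val g) (q, z) by split=> //; exists y.
  have [pf _] := set_valP f; apply: pf fy _.
  have /(congr1 val) /= e := compS f g Sf Sg.
  by move: fgz; rewrite /pf_algebra /= in e *; rewrite e => -[].
exists (SigSub (mem_set GFU)); split=> [f Sf|g ubg]; apply/GF_leE => /= p.
  by exists f.
by move=> [f /ubg/GF_leE]; apply.
Qed.

Section EtaCompletion.
Context {A : algebra} (reprA : representable A).

Lemma eta_hom : atomic A -> is_hom (eta reprA).
Proof.
move=> atomicA; split=> a b; apply: val_inj; apply/seteqP;
  split=> -[q x] /=; have atx := set_valP x.
- move=> /eta_setE[-> /(atom_le_diff reprA _ _ atx)[xa nxb]].
  by split; [apply/eta_setE|move/eta_setE => -[]].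
- move=> [/eta_setE[-> xa] nxb]; apply/eta_setE; split=> //.
  by apply/(atom_le_diff reprA _ _ atx); split=> // xb; apply/nxb/eta_setE.
- move=> /eta_setE[-> /(atom_le_restr reprA _ _ atomicA atx)].
  move=> [xb [y [aty ya xy]]].
  split; last exact/eta_setE.
  pose y' : atoms A := SigSub (mem_set (aty : atoms A y)).
  exists y'; apply/eta_setE; split=> //.
  by apply/(atom_proj_eq reprA).
- move=> [[y /= /eta_setE[qy ya]] /eta_setE[qx xb]].
  apply/eta_setE; split=> //; apply/(atom_le_restr reprA _ _ atomicA atx).
  split=> //; exists (val y); split=> //; first exact: set_valP.
  by apply/(atom_proj_eq reprA); rewrite -qx.
Qed.

Lemma eta_injective : atomic A -> injective (eta reprA).
Proof.
move=> atomicA a b /(congr1 val) /= ab.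
have mono (c d : A) : eta_set c = eta_set d -> le c d.
  move=> cd; apply: (atomic_le reprA atomicA) => x atx xc.
  pose x' : atoms A := SigSub (mem_set (atx : atoms A x)).
  have : eta_set c (atom_proj x', x') by apply/eta_setE.
  by rewrite cd => /eta_setE[].
by apply: (le_anti reprA); apply: mono.
Qed.

(** On atoms, [eta] is the singleton map, because the only atom below the atom
    [x] is [x]. *)
Lemma eta_atomE (x y : atoms A) q :
  eta_set (val x) (q, y) <-> q = atom_proj x /\ y = x.
Proof.
rewrite eta_setE; split=> [[-> yx]|[-> ->]]; last by split=> //; exact: le_refl.
have [_ xmin] := set_valP x; have [y0 _] := set_valP y.
by have -> : y = x by apply/val_inj/xmin.
Qed.

Lemma eta_join_dense : join_dense (range (eta reprA)).
Proof.
move=> f; have [_ sf] := set_valP f.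
exists [set eta reprA (val x) | x in [set x | val f (atom_proj x, x)]].
split; first by move=> _ [x _ <-]; exists (val x).
split=> [_ [x fx <-]|g ubg]; apply/GF_leE => -[q y].
  by move=> /eta_atomE[-> ->].
move=> fqy; have [x _ [qE yE]] := sf _ fqy; subst q y.
have /GF_leE : le (eta reprA (val x)) g by apply: ubg; exists x.
by apply; apply/eta_atomE.
Qed.

End EtaCompletion.

Theorem theorem4p12 (A : algebra) (reprA : representable A)
    (atomicA : atomic A) :
  is_compatible_completion (eta reprA).
Proof.
split.
- by split; [exact: eta_hom|exact: eta_injective].
- exact: pf_algebra_representable.
- exact: GF_compatibly_complete.
- exact: eta_join_dense.
Qed.
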